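(* Let $\mathcal{H}$ be a collection of nonempty loopless graphs, each having an even number of edges. Then for every $\varepsilon>0$ there exists a positive integer $n_0=n_0(\varepsilon,\mathcal{H})$ such that for every $n\geq n_0$, if $\mathcal{G}\subseteq\mathbb{F}_2^{\binom{[n]}{2}}$ is an $\mathcal{H}$-code with $\mathbb{P}[\mathcal{G}]=\delta_n(\mathcal{H})$, then $$\big\|\mathbb{1}_{\mathcal{G}}-\mathbb{P}[\mathcal{G}]\big\|_{U_2}\leq\varepsilon.$$
   Context: Graphs: for a nonempty finite set $V$, $\binom{V}{\leq 2}$ denotes the set of nonempty subsets of $V$ with at most two elements and $\binom{V}{2}$ the set of $2$-element subsets. A graph on $V$ is a subset of $\binom{V}{\leq 2}$; its elements of size $2$ are edges and of size $1$ self-loops; it is loopless if it has no self-loops. The spanning vertex set $V(G)$ is the union of the members of $G$. Graphs $G,H$ are isomorphic if there is a bijection $\phi\colon V(G)\to V(H)$ with $\{x,y\}\in G\iff\{\phi(x),\phi(y)\}\in H$ for all $x,y\in V(G)$. For graphs on the same vertex set, $G_1+G_2$ denotes symmetric difference. Loopless graphs on $[n]$ are identified with elements of $\mathbb{F}_2^{\binom{[n]}{2}}$ via indicators; $\mathbb{P}$ is the uniform probability measure on $\mathbb{F}_2^{\binom{[n]}{2}}$ and $\mathbb{E}$ the corresponding expectation. An $\mathcal{H}$-code is a family $\mathcal{G}$ of graphs on a common vertex set such that for all $G_1,G_2\in\mathcal{G}$, $G_1+G_2$ is not isomorphic to any graph of $\mathcal{H}$. $\delta_n(\mathcal{H})$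 is the maximum of $\mathbb{P}[\mathcal{G}]$ over all $\mathcal{H}$-codes $\mathcal{G}\subseteq\mathbb{F}_2^{\binom{[n]}{2}}$. Gowers norm: for a nonempty finite set $\mathcal{I}$, $d\geq 2$ and $f\colon\mathbb{F}_2^{\mathcal{I}}\to\mathbb{C}$, $\|f\|_{U_d}=\Big|\mathbb{E}_{x,y_1,\dots,y_d\in\mathbb{F}_2^{\mathcal{I}}}\prod_{s\subseteq[d]}\mathcal{C}^{|s|}f\big(x+\sum_{i\in s}y_i\big)\Big|^{1/2^d}$, where $\mathcal{C}$ is complex conjugation. *)

(* Defs.v *)
(* with mathcomp-reals (realType) and mathcomp-real-closed (R[i]). *)
From HB Require Import structures.
From mathcomp Require Import all_boot all_order all_algebra.
From mathcomp Require Import boolp reals.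
From mathcomp Require Import complex.
Set Implicit Arguments. Unset Strict Implicit. Unset Printing Implicit Defensive.
Import Order.TTheory GRing.Theory Num.Theory.
Local Open Scope ring_scope.

(* ---------- Graphs on a finite vertex type T ---------- *)
(* A graph on T is a set of nonempty subsets of T of size at most 2. *)
Definition is_graph (T : finType) (E : {set {set T}}) : Prop :=
  forall A, A \in E -> (0 < #|A| <= 2)%N.

(* loopless: no self-loops, i.e. every member is a 2-element set *)
Definition loopless (T : finType) (E : {set {set T}}) : Prop :=
  forall A, A \in E -> #|A| = 2%N.

(* number of edges (members of size 2) *)
Definition num_edges (T : finType) (E : {set {set T}}) : nat :=
  #|[set A in E | #|A| == 2%N]|.

(* spanning vertex set V(G) = union of the members of G *)
Definition span_vert (T : finType) (E : {set {set T}}) : {set T} :=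
  \bigcup_(A in E) A.

(* Isomorphism: a bijection phi : V(G) -> V(H) with
   {x,y} \in G <-> {phi x, phi y} \in H for all x, y in V(G). *)
Definition gr_iso (T U : finType) (G : {set {set T}}) (H : {set {set U}}) : Prop :=
  exists phi : T -> U,
    [/\ {in span_vert G &, injective phi},
        phi @: span_vert G = span_vert H &
        forall x y, x \in span_vert G -> y \in span_vert G ->
          ([set x; y] \in G) = ([set phi x; phi y] \in H)].

(* A collection of graphs, given (up to relabelling) as graphs on [m] = 'I_m. *)
Definition graph_family := forall m : nat, {set {set 'I_m}} -> Prop.

(* ---------- F_2^{binom([n],2)} ---------- *)
Definition pair_set (n : nat) := {A : {set 'I_n} | #|A| == 2%N}.
Definition gvec (n : nat) := {ffun pair_set n -> 'F_2}.

(* the loopless graph on [n] with indicator vector x *)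
Definition graph_of (n : nat) (x : gvec n) : {set {set 'I_n}} :=
  [set val e | e in [pred e : pair_set n | x e != 0]].

(* H-code: for all G1, G2 in the family, G1 + G2 is not isomorphic to any graph of H *)
Definition is_code (H : graph_family) (n : nat) (G : {set gvec n}) : Prop :=
  forall G1 G2, G1 \in G -> G2 \in G ->
    forall m (K : {set {set 'I_m}}), H m K -> ~ gr_iso (graph_of (G1 + G2)) K.

(* uniform probability on F_2^{binom([n],2)} *)
Definition prob (R : realType) (n : nat) (G : {set gvec n}) : R :=
  #|G|%:R / #|{: gvec n}|%:R.

(* delta_n(H): maximum of P[G] over all H-codes G (the empty family is a code) *)
Definition delta (R : realType) (H : graph_family) (n : nat) : R :=
  \big[Num.max/0]_(G : {set gvec n} | `[< is_code H G >]) prob R G.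

(* ---------- Gowers U_d norm ---------- *)
(* For f : F_2^I -> C,
   ||f||_{U_d} = | E_{x,y_1..y_d} prod_{s subset [d]} conj^{|s|} f(x + sum_{i in s} y_i) |^{1/2^d}. *)
Definition gowers_norm (C : numClosedFieldType) (I : finType) (d : nat)
    (f : {ffun I -> 'F_2} -> C) : C :=
  (2 ^ d).-root `| (#|{: {ffun I -> 'F_2}}| ^ d.+1)%:R^-1 *
     \sum_(x : {ffun I -> 'F_2}) \sum_(y : {ffun 'I_d -> {ffun I -> 'F_2}})
        \prod_(s : {set 'I_d})
           iter #|s| (fun z : C => z^*) (f (x + \sum_(i in s) y i)) |.

(* Main.v *)
(** Since [||f||_{U_2}^4] is the sum of the fourth powers of the Fourier coefficients of [f], it
    is enough to bound the coefficient of an optimal code [G] at every [S <> 0].  By Ramsey's theorem,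
    [S], viewed as a graph on [n], is empty or complete on some [m]-subset.  Split [G] into fibres
    by fixing the edges outside that subset; each fibre is a code on [m] vertices, hence has
    density at most [delta_m], while the average density is [delta_n].  If [S] is empty there, its
    coefficient only sees the fibre densities, which deviate from the constant [delta_m] by
    [delta_m - delta_n] on average.  If [S] is complete there, the coefficient measures the imbalance
    of the fibres between even and odd graphs; as all graphs of [H] have evenly many edges, each
    parity class of a code on [m] vertices has density at most [delta_m / 2], so the imbalance is at
    most [delta_m] minus the density.  Either way the coefficient is at most [delta_m - delta_n],
    which is small if [delta_m] is close to the infimum of all the [delta_k]. *)
Require Import Defs.
From HB Require Import structures.
From mathcomp Require Import all_boot all_order all_algebra.
From mathcomp Require Import boolp reals.
From mathcomp Require Import complex.
From mathcomp Require classical_sets.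
From mathcomp Require Import ring lra.
From mathcomp Require Import zify.
Import Order.TTheory GRing.Theory Num.Theory.
Local Open Scope ring_scope.
Local Open Scope complex_scope.

(** * Fourier analysis on $\mathbb{F}_2^I$ *)

Lemma F2_add_neq0 (a b : 'F_2) : (a + b != 0) = (a != 0) (+) (b != 0).
Proof. by case: a b => [[|[|//]] ?] [[|[|//]] ?]. Qed.

Lemma addxx_F2 {I : finType} (x : {ffun I -> 'F_2}) : x + x = 0.
Proof.
by apply/ffunP => i; rewrite !ffunE; case: (x i) => [[|[|//]] ?]; apply/val_inj.
Qed.

Lemma addK_F2 {I : finType} (x y : {ffun I -> 'F_2}) : x + (x + y) = y.
Proof. by rewrite addrA addxx_F2 add0r. Qed.

Lemma sum_translate {R : nmodType} {I : finType} (a : {ffun I -> 'F_2})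
    (F : {ffun I -> 'F_2} -> R) : \sum_(x : {ffun I -> 'F_2}) F (x + a) = \sum_x F x.
Proof. by rewrite [RHS](reindex_inj (addIr a)). Qed.

Section Walsh.
Context {R : realFieldType} {I : finType}.
Implicit Types (S x y : {ffun I -> 'F_2}) (g : {ffun I -> 'F_2} -> R).

(** The character $(-1)^{\langle S,x\rangle}$, as a product of signs over the coordinates. *)
Definition walsh S x : R := \prod_i (-1) ^+ ((S i != 0) && (x i != 0)).

Lemma walshC S x : walsh S x = walsh x S.
Proof. by apply: eq_bigr => i _; rewrite andbC. Qed.

Lemma walshD S x y : walsh S (x + y) = walsh S x * walsh S y.
Proof.
rewrite -big_split; apply: eq_bigr => i _ /=.
by rewrite ffunE F2_add_neq0 -signr_addb; case: (S i != 0).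
Qed.

Lemma walsh0 x : walsh 0 x = 1.
Proof. by apply: big1 => i _; rewrite ffunE eqxx. Qed.

Lemma walsh_pm1 S x : {b : bool | walsh S x = (-1) ^+ b}.
Proof.
exists (odd (\sum_i ((S i != 0%R) && (x i != 0%R)))).
by rewrite signr_odd /walsh prodrXr.
Qed.

Lemma normr_walsh S x : `|walsh S x| = 1.
Proof. by have [b ->] := walsh_pm1 S x; rewrite normr_sign. Qed.

Lemma walsh_delta S i : S i != 0 -> walsh S [ffun j => (j == i)%:R] = -1.
Proof.
move=> Si; rewrite /walsh (bigD1 i) //= big1 ?mulr1 ?ffunE ?eqxx ?Si ?oner_eq0 //.
by move=> j /negPf ji; rewrite ffunE ji eqxx andbF.
Qed.

(** Translating by the indicator of a coordinate in the support of [S] flips the sign of the sum. *)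
Lemma sum_walsh S : S != 0 -> \sum_x walsh S x = 0.
Proof.
move=> S0; have [i Si] : exists i, S i != 0.
  apply/existsP; apply: contraNT S0; rewrite negb_exists => /forallP S0.
  by apply/eqP/ffunP => i; rewrite ffunE; apply/eqP; have := S0 i; rewrite negbK.
have := sum_translate [ffun j => (j == i)%:R] (walsh S).
under eq_bigr do rewrite walshD walsh_delta // mulrN1.
by rewrite sumrN => h; lra.
Qed.

Lemma parseval g :
  \sum_S (\sum_x g x * walsh S x) ^+ 2 =
  #|{: {ffun I -> 'F_2}}|%:R * \sum_x g x ^+ 2.
Proof.
have E S : (\sum_x g x * walsh S x) ^+ 2 =
    \sum_x \sum_y g x * g y * walsh (x + y) S.
  rewrite expr2 mulr_suml; apply: eq_bigr => x _; rewrite mulr_sumr.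
  by apply: eq_bigr => y _; rewrite (walshC (x + y)) walshD; ring.
under eq_bigr do rewrite E.
rewrite exchange_big mulr_sumr; apply: eq_bigr => x _ /=.
rewrite exchange_big (bigD1 x) //= [X in _ + X]big1 => [|y yx].
  rewrite addr0 addxx_F2.
  under eq_bigr do rewrite walsh0 mulr1.
  by rewrite sumr_const mulr_natl expr2.
rewrite -mulr_sumr sum_walsh ?mulr0 //.
by apply: contraNneq yx => h; rewrite -(addK_F2 x y) h addr0.
Qed.

(** In characteristic 2 the autocorrelation of [g] is its convolution with itself, so its transform
    is the square of that of [g]. *)
Lemma walsh_convolution g S :
  \sum_(y : {ffun I -> 'F_2}) (\sum_x g x * g (x + y)) * walsh S y =
  (\sum_x g x * walsh S x) ^+ 2.
Proof.
under eq_bigr do rewrite mulr_suml.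
rewrite exchange_big expr2 mulr_suml; apply: eq_bigr => x _ /=.
rewrite mulr_sumr -[RHS](sum_translate x).
apply: eq_bigr => y _; rewrite [y + x]addrC walshD.
have [b ->] := walsh_pm1 S x; have := sqrr_sign R b; rewrite expr2 => e.
have -> : g x * (-1) ^+ b * (g (x + y) * ((-1) ^+ b * walsh S y)) =
  g x * g (x + y) * walsh S y * ((-1) ^+ b * (-1) ^+ b) by ring.
by rewrite e mulr1.
Qed.

(* The left-hand side is the unnormalised fourth power of the U_2 norm of [g]. *)
Lemma autocorrelation_le g (M : R) :
    (forall S, `|\sum_x g x * walsh S x| <= M) ->
  \sum_(y : {ffun I -> 'F_2}) (\sum_x g x * g (x + y)) ^+ 2 <= M ^+ 2 * \sum_x g x ^+ 2.
Proof.
move=> hM; have N0 : 0 < #|{: {ffun I -> 'F_2}}|%:R :> R.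
  by rewrite ltr0n; apply/card_gt0P; exists 0.
(* Parseval for the autocorrelation on the left and for [g] on the right; the terms are then
   compared for each [S]. *)
rewrite -(ler_pM2l N0) -parseval mulrCA -parseval mulr_sumr.
apply: ler_sum => S _; rewrite walsh_convolution expr2.
by rewrite ler_wpM2r ?sqr_ge0 // -[leLHS]real_normK ?num_real // lerXn2r ?nnegrE
  ?normr_ge0 // (le_trans _ (hM S)).
Qed.

End Walsh.

(** * Ramsey's theorem for two colours *)

Lemma ramsey {T : finType} (e : rel T) (s t : nat) (A : {set T}) :
    symmetric e -> (2 ^ (s + t) <= #|A|)%N ->
  (exists B : {set T}, [/\ B \subset A, #|B| = s &
     {in B &, forall x y, x != y -> e x y}]) \/
  (exists B : {set T}, [/\ B \subset A, #|B| = t &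
     {in B &, forall x y, x != y -> ~~ e x y}]).
Proof.
move=> se; have [k] := ubnP (s + t); elim: k => // k IH in s t A *.
case: s => [|s]; first by left; exists set0; split; rewrite ?sub0set ?cards0 // => x; rewrite inE.
case: t => [|t]; first by right; exists set0; split; rewrite ?sub0set ?cards0 // => x; rewrite inE.
move=> hk hA.
have /card_gt0P[x xA] : (0 < #|A|)%N by apply: leq_trans hA; rewrite expn_gt0.
pose N := [set y in A :\ x | e x y]; pose N' := [set y in A :\ x | ~~ e x y].
have hN : (#|A| = (#|N| + #|N'|).+1)%N.
  rewrite (cardsD1 x) xA add1n -(cardsID [set y | e x y]); congr (_ + _).+1.
    by apply: eq_card => y; rewrite !inE.
  by apply: eq_card => y; rewrite !inE andbC.
have NA : N \subset A by apply/subsetP => y; rewrite !inE => /andP[/andP[]].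
have NA' : N' \subset A by apply/subsetP => y; rewrite !inE => /andP[/andP[]].
(* The relation [r] stands for [e] or its negation, so that both colours share the argument. *)
have ext (B C : {set T}) (r : rel T) : symmetric r -> C \subset A ->
    {in C, forall y, y != x /\ r x y} ->
    B \subset C -> {in B &, forall y z, y != z -> r y z} ->
    [/\ x |: B \subset A, #|x |: B| = #|B|.+1 &
        {in x |: B &, forall y z, y != z -> r y z}].
  move=> sr CA hC BC hB; split.
  - by rewrite subUset sub1set xA (subset_trans BC).
  - by rewrite cardsU1; case: (boolP (x \in B)) => // /(subsetP BC)/hC[]; rewrite eqxx.
  - move=> y z; rewrite !inE => /predU1P[->|yB] /predU1P[->|zB].
    + by rewrite eqxx.
    + by have [] := hC z (subsetP BC z zB).
    + by rewrite sr; have [] := hC y (subsetP BC y yB).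
    + exact: hB.
(* The two sides have $|A|-1$ elements together and $|A|\geq 2\cdot 2^{s+t+1}$, so even without [x]
   one side is large enough for the induction on the sum of the two sizes. *)
have [hh|hh] : (2 ^ (s + t.+1) <= #|N| \/ 2 ^ (s.+1 + t) <= #|N'|)%N.
- move: hA; rewrite hN addSn expnS addSnnS mul2n -addnn; lia.
- have lt_k : (s + t.+1 < k)%N by lia.
  have [[B [BN Bs hB]]|[B [BN Bs hB]]] := IH s t.+1 N lt_k hh.
    left; exists (x |: B); rewrite -Bs; apply: (ext B N e) => // y.
    by rewrite !inE => /andP[/andP[]].
  by right; exists B; split=> //; apply: subset_trans NA.
- have lt_k : (s.+1 + t < k)%N by lia.
  have [[B [BN Bs hB]]|[B [BN Bs hB]]] := IH s.+1 t N' lt_k hh.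
    by left; exists B; split=> //; apply: subset_trans NA'.
  right; exists (x |: B); rewrite -Bs.
  apply: (ext B N' (fun x y => ~~ e x y)) => //; first by move=> y z; rewrite se.
  by move=> y; rewrite !inE => /andP[/andP[]].
Qed.

(** * Graphs as vectors, and their isomorphisms *)

Lemma mem_graph_of {n} (x : gvec n) (e : pair_set n) :
  (val e \in graph_of x) = (x e != 0).
Proof.
apply/imsetP/idP => [[e' h /val_inj->]|h]; last by exists e.
by rewrite inE in h.
Qed.

Lemma graph_ofP {n} (x : gvec n) (A : {set 'I_n}) :
  A \in graph_of x -> exists2 e : pair_set n, A = val e & x e != 0.
Proof. by case/imsetP => e h ->; exists e => //; rewrite inE in h. Qed.

Lemma loopless_graph_of {n} (x : gvec n) : loopless (graph_of x).
Proof. by move=> A /graph_ofP[e -> _]; apply/eqP/(valP e). Qed.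

(** The vertex bijection induces a bijection of the edge sets, as every member is a pair of spanning
    vertices. *)
Lemma gr_iso_card {T U : finType} (G : {set {set T}}) (K : {set {set U}}) :
  loopless G -> loopless K -> gr_iso G K -> #|G| = #|K|.
Proof.
move=> lG lK [phi [inj im h]].
have span (V : finType) (L : {set {set V}}) A x : A \in L -> x \in A -> x \in span_vert L.
  by move=> AL xA; apply/bigcupP; exists A.
have -> : K = (fun A : {set T} => phi @: A) @: G.
  apply/setP => B; apply/idP/imsetP => [BK|[A AG ->]].
    have /eqP/cards2P[a [b [ab eB]]] := lK _ BK.
    have : a \in phi @: span_vert G by rewrite im (span _ K B) // eB !inE eqxx.
    case/imsetP => x xG ex.
    have : b \in phi @: span_vert G by rewrite im (span _ K B) // eB !inE eqxx orbT.
    case/imsetP => y yG ey.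
    exists [set x; y]; first by rewrite h // -ex -ey -eB.
    by rewrite imsetU !imset_set1 -ex -ey.
  have /eqP/cards2P[x [y [xy eA]]] := lG _ AG.
  rewrite eA imsetU !imset_set1 -h -?eA //; apply: (span _ _ _ _ AG);
    by rewrite eA !inE eqxx ?orbT.
rewrite card_in_imset // => A B AG BG /setP eAB; apply/setP => x.
apply/idP/idP => xX.
  have := eAB (phi x); rewrite imset_f // => /esym/imsetP[y yB /inj].
  by move=> -> //; [exact: span xX | exact: span yB].
have := eAB (phi x); rewrite [X in _ = X]imset_f // => /imsetP[y yB /inj].
by move=> -> //; [exact: span xX | exact: span yB].
Qed.

(** * Transporting graphs along an injection of vertices *)

Section Embedding.
Context {m n : nat} {f : 'I_m -> 'I_n} (f_inj : injective f).

Lemma pair_img_subproof (p : pair_set m) : #|f @: val p| == 2%N.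
Proof. by rewrite card_imset // (valP p). Qed.

Definition pair_img (p : pair_set m) : pair_set n :=
  exist (fun A : {set 'I_n} => #|A| == 2%N) _ (pair_img_subproof p).

Lemma pair_img_inj : injective pair_img.
Proof. by move=> p q /(congr1 val)/(imset_inj f_inj)/val_inj. Qed.

Definition emb (v : gvec m) : gvec n :=
  [ffun e => if [pick p | pair_img p == e] is Some p then v p else 0].

Lemma emb_pair_img v p : emb v (pair_img p) = v p.
Proof.
rewrite ffunE; case: pickP => [q /eqP/pair_img_inj->//|/(_ p)].
by rewrite eqxx.
Qed.

Lemma emb_neq0 v e : emb v e != 0 -> exists2 p, e = pair_img p & v p != 0.
Proof. by rewrite ffunE; case: pickP => [p /eqP <-|]; [exists p | rewrite eqxx]. Qed.

Lemma embD v w : emb (v + w) = emb v + emb w.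
Proof. by apply/ffunP => e; rewrite !ffunE; case: pickP => [p _|_]; rewrite ?ffunE ?addr0. Qed.

Lemma graph_of_emb v : graph_of (emb v) = (fun A : {set 'I_m} => f @: A) @: graph_of v.
Proof.
apply/setP => A; apply/idP/imsetP => [/graph_ofP[e ->]|[B /graph_ofP[p -> vp] ->]].
  case/emb_neq0 => p -> vp; exists (val p) => //.
  by rewrite mem_graph_of.
by rewrite -[f @: _]/(val (pair_img p)) mem_graph_of emb_pair_img.
Qed.

(** [emb] only adds isolated vertices, which the spanning vertex set ignores. *)
Lemma gr_iso_emb v k (K : {set {set 'I_k}}) : loopless K -> K != set0 ->
  gr_iso (graph_of v) K -> gr_iso (graph_of (emb v)) K.
Proof.
move=> lK /set0Pn[B BK] [phi [inj im h]].
(* Default value of [psi] off the image of [f]; it exists because [K] has an edge. *)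
have /card_gt0P[k0 _] : (0 < #|B|)%N by rewrite lK.
pose psi (y : 'I_n) := if [pick x | f x == y] is Some x then phi x else k0.
have psif x : psi (f x) = phi x.
  rewrite /psi; case: pickP => [z /eqP/f_inj->//|/(_ x)]; by rewrite eqxx.
have spanE : span_vert (graph_of (emb v)) = f @: span_vert (graph_of v).
  rewrite /span_vert graph_of_emb big_imset /=; last by move=> A A' _ _ /(imset_inj f_inj).
  by apply/setP => y; apply/bigcupP/imsetP => [[A AG /imsetP[x xA ->]]|[x /bigcupP[A AG xA] ->]];
    [exists x => //; apply/bigcupP; exists A | exists A => //; exact: imset_f].
exists psi; rewrite spanE; split.
- move=> _ _ /imsetP[x xG ->] /imsetP[y yG ->]; rewrite !psif => /inj.
  by move=> /(_ xG yG) ->.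
- by rewrite -im -imset_comp; apply: eq_imset => x /=.
- move=> _ _ /imsetP[x xG ->] /imsetP[y yG ->]; rewrite !psif -h // graph_of_emb.
  rewrite -!imset_set1 -imsetU mem_imset //; exact: imset_inj.
Qed.

End Embedding.

(** * Codes: parity classes, fibres and Fourier coefficients *)

Section Codes.
Variables (R : realType) (H : graph_family).
Hypothesis hH : forall m (K : {set {set 'I_m}}), H m K ->
  [/\ is_graph K, loopless K, K != set0 & ~~ odd (num_edges K)].

Lemma prob_le_delta {n} (C : {set gvec n}) : is_code H C -> prob R C <= delta R H n.
Proof. by move=> hC; apply: le_bigmax_cond; apply/asboolP. Qed.

Lemma card_gvec_gt0 n : 0 < #|{: gvec n}|%:R :> R.
Proof. by rewrite ltr0n; apply/card_gt0P; exists 0. Qed.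

Lemma card_code_le {n} (C : {set gvec n}) :
  is_code H C -> #|C|%:R <= delta R H n * #|{: gvec n}|%:R.
Proof. by move/prob_le_delta; rewrite ler_pdivrMr ?card_gvec_gt0. Qed.

(** The character of the complete graph is the edge parity. *)
Lemma walsh1E {n} (v : gvec n) : walsh [ffun=> 1] v = (-1) ^+ #|graph_of v| :> R.
Proof.
rewrite /walsh prodrXr card_imset; last exact: val_inj.
congr (_ ^+ _); rewrite -sum1_card [RHS]big_mkcond; apply: eq_bigr => e _.
by rewrite ffunE inE; case: (v e != 0).
Qed.

(** The evenness of the graphs of [H] enters here. *)
Lemma walsh1_gr_iso {n} (v : gvec n) m (K : {set {set 'I_m}}) :
  H m K -> gr_iso (graph_of v) K -> walsh [ffun=> 1] v = 1 :> R.
Proof.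
move=> HK iso; have [_ lK _] := hH m K HK.
have -> : num_edges K = #|K|.
  by apply: eq_card => A; rewrite inE; case: (boolP (A \in K)) => //= /lK ->.
rewrite walsh1E (gr_iso_card _ _ (@loopless_graph_of _ v) lK iso).
by rewrite -signr_odd => /negPf->.
Qed.

(* All graphs of [H] have evenly many edges, so a code of constant edge parity stays a code
   after adjoining its translate by a single edge, which has the opposite parity. *)
Lemma card_parity_code {n} (C : {set gvec n}) (e : pair_set n) (s : R) :
    is_code H C -> {in C, forall v, walsh [ffun=> 1] v = s} ->
  2 * #|C|%:R <= delta R H n * #|{: gvec n}|%:R.
Proof.
move=> hC hs; pose d : gvec n := [ffun j => (j == e)%:R].
have wd : walsh [ffun=> 1] d = -1 :> R by rewrite walsh_delta // ffunE oner_eq0.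
have wDd v : v \in C -> walsh [ffun=> 1] (v + d) = - s.
  by move=> /hs hv; rewrite walshD hv wd mulrN1.
have s1 : s * s = 1 \/ C = set0.
  have [->|[v /hs <-]] := set_0Vmem C; first by right.
  by left; have [b ->] := walsh_pm1 (R := R) [ffun=> 1] v; rewrite -expr2 sqrr_sign.
case: s1 => [s1|->]; last first.
  by rewrite cards0 mulr0 mulr_ge0 ?ler0n // bigmax_ge_id.
pose C' := (fun v : gvec n => v + d) @: C.
have dis : [disjoint C & C'].
  rewrite disjoint_subset; apply/subsetP => v vC; rewrite inE; apply/imsetP => -[w wC e'].
  by have := wDd w wC; rewrite -e' hs // => h; nra.
have -> : 2 * #|C|%:R = #|C :|: C'|%:R :> R.
  rewrite cardsU disjoint_setI0 // cards0 subn0 card_imset; last exact: addIr.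
  by rewrite natrD; ring.
apply: card_code_le => v w vC wC k K HK iso.
(* The sum must be even, which excludes a member of [C] plus a translate; for two translates [d]
   cancels. *)
have := walsh1_gr_iso _ _ _ HK iso; rewrite walshD.
move: vC wC; rewrite !inE.
case/orP => [vC|/imsetP[v' v'C ev]]; case/orP => [wC|/imsetP[w' w'C ew]].
- by move=> _; exact: (hC v w vC wC _ _ HK).
- by rewrite ew wDd // hs // => h; nra.
- by rewrite ev wDd // hs // => h; nra.
- move=> _; apply: (hC v' w' v'C w'C _ _ HK).
  suff <- : v + w = v' + w' by [].
  by rewrite ev ew addrACA addxx_F2 addr0.
Qed.

Lemma sub_code {n} (C D : {set gvec n}) : C \subset D -> is_code H D -> is_code H C.
Proof. by move=> /subsetP CD hD v w /CD vD /CD wD; apply: hD. Qed.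

(** With $a$ even and $b$ odd members, $|a-b|=2\max(a,b)-(a+b)$, and [card_parity_code] bounds both
    $2a$ and $2b$. *)
Lemma code_parity_bias {n} (C : {set gvec n}) (e : pair_set n) : is_code H C ->
  `|\sum_(v in C) walsh [ffun=> 1] v| <= delta R H n * #|{: gvec n}|%:R - #|C|%:R.
Proof.
move=> hC; pose Cs (s : R) := [set v in C | walsh [ffun=> 1] v == s].
have hCs s : 2 * #|Cs s|%:R <= delta R H n * #|{: gvec n}|%:R.
  apply: (card_parity_code (Cs s) e s); last by move=> v; rewrite inE => /andP[_ /eqP].
  by apply: sub_code hC; apply/subsetP => v; rewrite inE => /andP[].
have N11 : (-1 == 1 :> R) = false by apply/negbTE/eqP; lra.
have cardE : #|C|%:R = #|Cs 1|%:R + #|Cs (-1)|%:R :> R.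
  rewrite -natrD -(cardsID [set v | walsh [ffun=> 1] v == 1 :> R]); congr (_ + _)%:R.
    by apply: eq_card => v; rewrite !inE.
  apply: eq_card => v; rewrite !inE andbC; congr (_ && _).
  by have [[] ->] := walsh_pm1 (R := R) [ffun=> 1] v; rewrite ?expr1 ?expr0 eqxx ?N11 // eq_sym N11.
have sumE : \sum_(v in C) walsh [ffun=> 1] v = #|Cs 1|%:R - #|Cs (-1)|%:R :> R.
  rewrite -!sum1_card !natr_sum.
  rewrite big_mkcond [X in _ = X - _]big_mkcond [X in _ = _ - X]big_mkcond -sumrB.
  apply: eq_bigr => v _; rewrite !inE; case: (v \in C) => /=; last by rewrite subr0.
  have [[] ->] := walsh_pm1 (R := R) [ffun=> 1] v; rewrite ?expr1 ?expr0 eqxx ?N11 ?sub0r ?subr0 //.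
  by rewrite eq_sym N11 subr0.
rewrite sumE cardE; have := hCs 1; have := hCs (-1) => h1 h2.
by rewrite ler_norml; lra.
Qed.

(** The base point [x] cancels in the sum of two members. *)
Lemma fibre_code {m n} (f : 'I_m -> 'I_n) (f_inj : injective f) (G : {set gvec n}) x :
  is_code H G -> is_code H [set v | x + emb f_inj v \in G].
Proof.
move=> hG v w; rewrite !inE => vG wG k K HK iso.
have [_ lK K0 _] := hH k K HK.
apply: (hG _ _ vG wG _ _ HK); rewrite addrACA addxx_F2 add0r -embD.
exact: gr_iso_emb.
Qed.

Lemma homogeneous_embedding {m n} (S : gvec n) : (2 ^ (m + m) <= n)%N ->
  exists (f : 'I_m -> 'I_n) (f_inj : injective f),
    (forall p, S (pair_img f_inj p) != 0) \/ (forall p, S (pair_img f_inj p) = 0).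
Proof.
move=> mn; pose e i j := [exists p : pair_set n, (val p == [set i; j]) && (S p != 0)].
have se : symmetric e by move=> i j; rewrite /e setUC.
have eP (p : pair_set n) i j : val p = [set i; j] -> e i j = (S p != 0).
  move=> ep; apply/existsP/idP => [[q /andP[/eqP eq]]|h]; last by exists p; rewrite ep eqxx.
  by rewrite (_ : q = p) //; apply: val_inj; rewrite ep eq.
have emb_of (B : {set 'I_n}) : #|B| = m ->
    exists2 f : 'I_m -> 'I_n, injective f & forall i, f i \in B.
  move=> <-; exists enum_val; [exact: enum_val_inj | exact: enum_valP].
have pairE (f : 'I_m -> 'I_n) (f_inj : injective f) (p : pair_set m) : exists x y,
    x != y /\ val (pair_img f_inj p) = [set f x; f y].
  have /cards2P[x [y [xy exy]]] := valP p; exists x, y; split=> //=.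
  by rewrite exy imsetU !imset_set1.
have := ramsey e m m [set: 'I_n] se; rewrite cardsT card_ord => /(_ mn).
case=> -[B [_ /emb_of[f f_inj fB] hB]]; exists f, f_inj; [left|right] => p;
  have [x [y [xy exy]]] := pairE f f_inj p; have := hB _ _ (fB x) (fB y);
  rewrite (inj_eq f_inj) (eP _ _ _ exy) => /(_ xy) //.
by rewrite negbK => /eqP.
Qed.

Lemma fourier_code_le {m n} (G : {set gvec n}) (S : gvec n) :
    (2 ^ (m + m) <= n)%N -> is_code H G -> S != 0 ->
  `|\sum_(x in G) walsh S x| <= (delta R H m - prob R G) * #|{: gvec n}|%:R.
Proof.
move=> mn hG S0; have [f [f_inj hom]] := homogeneous_embedding (m := m) S mn.
(* Rather than decomposing a graph along the embedded vertex set, average over its translates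
   by the graphs supported there. *)
pose Gx x := [set v | x + emb f_inj v \in G].
pose M : R := #|{: gvec m}|%:R; pose N : R := #|{: gvec n}|%:R.
have M0 : 0 < M := card_gvec_gt0 m; have N0 : 0 < N := card_gvec_gt0 n.
(* Translation by each [emb f_inj v] permutes all graphs, so every member of [G] is counted [M]
   times. *)
have avg (F : gvec n -> R) :
    M * \sum_(x in G) F x = \sum_x \sum_(v in Gx x) F (x + emb f_inj v).
  under [RHS]eq_bigr do rewrite big_mkcond /=.
  rewrite exchange_big /=.
  under [RHS]eq_bigr => v _.
    under eq_bigr do rewrite inE.
    rewrite (sum_translate _ (fun y => if y \in G then F y else 0)) -big_mkcond.
    over.
  by rewrite sumr_const mulr_natl.
have cardG : \sum_x #|Gx x|%:R = M * #|G|%:R.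
  under eq_bigr do rewrite -sum1_card natr_sum.
  by rewrite -(avg (fun=> 1)) -sum1_card natr_sum.
have [h [hE hle]] : exists h : gvec n -> R,
    M * \sum_(x in G) walsh S x = \sum_x walsh S x * h x /\
    forall x, `|h x| <= delta R H m * M - #|Gx x|%:R.
  rewrite avg.
  have hGx x : is_code H (Gx x) by exact: fibre_code.
  (* For [m < 2] there are no pairs and both cases of [hom] hold vacuously; this new split provides
     the pair [p] that [code_parity_bias] asks for. *)
  have [hS|[p Sp]] : (forall p, S (pair_img f_inj p) = 0) \/ exists p, S (pair_img f_inj p) != 0.
  - case: (pselect (exists p, S (pair_img f_inj p) != 0)) => [|hn]; first by right.
    by left=> p; apply/eqP; apply: contrapT => /negP hp; apply: hn; exists p.
  (* The constant may be subtracted because the character of [S] sums to zero; the absolute value is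
     then the deficit of the fibre. *)
  - exists (fun x => #|Gx x|%:R - delta R H m * M); split=> [|x]; last first.
      have := card_code_le (Gx x) (hGx x); rewrite -/M => hx.
      by rewrite distrC ger0_norm ?subr_ge0.
    under [RHS]eq_bigr do rewrite mulrBr.
    rewrite sumrB -mulr_suml sum_walsh // mul0r subr0; apply: eq_bigr => x _.
    under eq_bigr => v _.
      rewrite walshD (_ : walsh S (emb f_inj v) = 1); last first.
        apply: big1 => e _; case: (boolP (emb f_inj v e != 0)) => [|_].
          by case/emb_neq0 => p -> _; rewrite hS eqxx.
        by rewrite andbF.
      over.
    by rewrite -mulr_sumr sumr_const.
  have {}hom q : S (pair_img f_inj q) != 0.
    by case: hom => [//|/(_ p) hp]; rewrite hp eqxx in Sp.
  exists (fun x => \sum_(v in Gx x) walsh [ffun=> 1] v); split=> [|x]; last first.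
    exact: code_parity_bias.
  apply: eq_bigr => x _; rewrite mulr_sumr; apply: eq_bigr => v _.
  (* [S] is nonzero on all embedded pairs, so [walsh S (emb f_inj v)] is the edge parity of [v]. *)
  rewrite walshD; congr (_ * _); rewrite walsh1E.
  rewrite -(card_imset _ (imset_inj f_inj)) -graph_of_emb -walsh1E.
  apply: eq_bigr => e _.
  have -> : ([ffun=> 1] : gvec n) e != 0 by rewrite ffunE oner_eq0.
  case: (boolP (emb f_inj v e != 0)) => [|_]; last by rewrite !andbF.
  by case/emb_neq0 => q -> _; rewrite hom.
rewrite -(ler_pM2l M0) -[X in X * `|_|]gtr0_norm // -normrM hE.
apply: le_trans (ler_norm_sum _ _ _) _.
apply: le_trans (_ : \sum_x (delta R H m * M - #|Gx x|%:R) <= _).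
  by apply: ler_sum => x _; rewrite normrM normr_walsh mul1r.
rewrite sumrB cardG sumr_const -mulr_natl -/N /prob -/N.
by rewrite le_eqVlt; apply/orP; left; apply/eqP; field; rewrite gt_eqF.
Qed.

(** Take [delta R H m] within [eta] of the infimum of all values, which exists as densities are
    nonnegative. *)
Lemma delta_near_inf (eta : R) : 0 < eta ->
  exists m, forall n, delta R H m - delta R H n <= eta.
Proof.
move=> eta0; pose E : classical_sets.set R := fun x => exists n, delta R H n = x.
have E0 : classical_sets.lbound E 0 by move=> _ [n <-]; exact: bigmax_ge_id.
have iE : classical_sets.has_inf E by split; [exists (delta R H 0); exists 0%N | exists 0].
have [_ [m <-] hm] := inf_adherent eta0 iE.
exists m => n; have : inf E <= delta R H n by apply: ge_inf; [exists 0 | exists n].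
lra.
Qed.

End Codes.

(** * The $U_2$ norm of a real function *)

Lemma sum_pow2 {V : nmodType} {T : finType} (F : {ffun 'I_2 -> T} -> V) :
  \sum_y F y = \sum_a \sum_b F [ffun i => if i == 0 then a else b].
Proof.
rewrite pair_bigA /=.
pose h (p : T * T) : {ffun 'I_2 -> T} := [ffun i => if i == 0 then p.1 else p.2].
rewrite (reindex h) //; exists (fun y : {ffun 'I_2 -> T} => (y 0, y 1)).
  by move=> [a b] _; rewrite !ffunE.
move=> y _; apply/ffunP => i; rewrite ffunE.
by case: (unliftP 0 i) => [j ->|->] //=; rewrite (ord1 j); congr (y _); apply: val_inj.
Qed.

Lemma prod_set2 {V : comPzSemiRingType} (F : {set 'I_2} -> V) :
  \prod_s F s = F [set: 'I_2] * F [set 0] * (F [set 1] * F set0).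
Proof.
pose h (p : bool * bool) : {set 'I_2} := [set i | if i == 0 then p.1 else p.2].
have ord2 (i : 'I_2) : i = 0 \/ i = 1.
  by case: (unliftP 0 i) => [j ->|->]; [right; rewrite (ord1 j); apply: val_inj | left].
rewrite (reindex h) /=; last first.
  exists (fun s : {set 'I_2} => (0 \in s, 1 \in s)) => [[a b]|s] _; first by rewrite !inE.
  by apply/setP => i; rewrite inE; case: (ord2 i) => ->.
rewrite -(pair_bigA _ (fun a b => F (h (a, b)))) /= !big_bool.
by congr (F _ * F _ * (F _ * F _)); apply/setP => i; rewrite !inE; case: (ord2 i) => ->.
Qed.

(** For a fixed direction $a$, summing over $x$ and $b$ the products over the parallelograms
    $x,x+a,x+b,x+a+b$ gives the squared autocorrelation at $a$. The cube normalises the three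
    averaged variables. *)
Lemma gowers2_real {R : rcfType} {I : finType} (g : {ffun I -> 'F_2} -> R) (eps : R) :
    0 <= eps ->
    \sum_(y : {ffun I -> 'F_2}) (\sum_x g x * g (x + y)) ^+ 2 <=
      eps ^+ 4 * #|{: {ffun I -> 'F_2}}|%:R ^+ 3 ->
  gowers_norm 2 (fun x => (g x)%:C) <= eps%:C.
Proof.
move=> eps0 hg; set Q := \sum_y _ in hg.
have N0 : 0 < #|{: {ffun I -> 'F_2}}|%:R ^+ 3 :> R.
  by rewrite exprn_gt0 // ltr0n; apply/card_gt0P; exists 0.
have QE : Q = \sum_(x : {ffun I -> 'F_2}) \sum_(y : {ffun 'I_2 -> {ffun I -> 'F_2}})
    \prod_(s : {set 'I_2}) g (x + \sum_(i in s) y i).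
  under [RHS]eq_bigr do rewrite sum_pow2.
  rewrite [RHS]exchange_big; apply: eq_bigr => a _ /=.
  rewrite expr2 mulr_suml; apply: eq_bigr => x _ /=.
  rewrite mulr_sumr -[LHS](sum_translate x); apply: eq_bigr => b _.
  rewrite prod_set2 big_set0 !big_set1 (big_setD1 0) ?inE //= (big_setD1 1) ?inE //=.
  rewrite (_ : _ :\ _ = set0); last first.
    by apply/setP => i; rewrite !inE; case: (unliftP 0 i) => [j ->|->]; rewrite ?(ord1 j).
  rewrite big_set0 !ffunE /= !addr0 (addrC b x) [a + b]addrC addrA; ring.
have Q0 : 0 <= Q by apply: sumr_ge0 => y _; exact: sqr_ge0.
rewrite /gowers_norm (_ : _ * _ = (#|{: {ffun I -> 'F_2}}|%:R ^- 3 * Q)%:C); last first.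
  rewrite (rmorphM (real_complex R)) (fmorphV (real_complex R)) (rmorphXn (real_complex R)).
  rewrite (rmorph_nat (real_complex R)) natrX; congr (_ * _).
  rewrite QE rmorph_sum; apply: eq_bigr => x _.
  rewrite rmorph_sum; apply: eq_bigr => y _.
  rewrite rmorph_prod; apply: eq_bigr => s _.
  by elim: #|s| => //= k ->; exact: conjc_real.
have A0 : 0 <= #|{: {ffun I -> 'F_2}}|%:R ^- 3 * Q.
  by rewrite mulr_ge0 // invr_ge0 ltW.
have epsE : eps%:C = 4.-root (eps ^+ 4)%:C :> R[i].
  by rewrite (rmorphXn (real_complex R)) exprCK ?lecR.
rewrite ger0_norm ?lecR // epsE ler_rootC ?nnegrE ?lecR ?exprn_ge0 //.
by rewrite mulrC ler_pdivrMr.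
Qed.

Theorem theorem1p12 (R : realType) (H : graph_family)
  (hH : forall m (K : {set {set 'I_m}}), H m K ->
          [/\ is_graph K, loopless K, K != set0 & ~~ odd (num_edges K)])
  (eps : R) (heps : 0 < eps) :
  exists n0 : nat, (0 < n0)%N /\
    forall n : nat, (n0 <= n)%N ->
    forall G : {set gvec n},
      is_code H G -> prob R G = delta R H n ->
      gowers_norm 2 (fun x : gvec n => ((x \in G)%:R - prob R G)%:C) <= eps%:C.
Proof.
(* Coefficients of size at most [eps ^+ 2 * N] give the required [eps ^+ 4 * N ^+ 3]: square, then
   multiply by the bound [N] for the sum of squares of [g]. *)
have [m hm] := delta_near_inf R H (eps ^+ 2) (exprn_gt0 2 heps).
exists (2 ^ (m + m))%N; split=> [|n mn G hG pG]; first by rewrite expn_gt0.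
pose g (x : gvec n) : R := (x \in G)%:R - prob R G.
apply: (gowers2_real g); first exact: ltW.
set N : R := #|_|%:R; have N0 : 0 < N := card_gvec_gt0 R n.
have p01 : 0 <= prob R G <= 1.
  by rewrite divr_ge0 ?ler0n //= ler_pdivrMr // mul1r ler_nat max_card.
apply: le_trans (autocorrelation_le g (eps ^+ 2 * N) _) _ => [S|].
  (* Subtracting the mean kills the coefficient at 0 and leaves the others unchanged. *)
  have [->|S0] := eqVneq S 0.
    under eq_bigr do rewrite walsh0 mulr1.
    have cardG : (\sum_(x : gvec n) (x \in G) = #|G|)%N.
      by rewrite -sum1_card [RHS]big_mkcond; apply: eq_bigr => x _; case: (x \in G).
    rewrite sumrB -natr_sum cardG sumr_const -[prob R G *+ _]mulr_natr.
    rewrite (_ : prob R G * _ = #|G|%:R); last by rewrite divfK ?gt_eqF.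
    by rewrite subrr normr0 mulr_ge0 ?sqr_ge0 ?ltW.
  under eq_bigr do rewrite mulrBl.
  rewrite sumrB -mulr_sumr sum_walsh // mulr0 subr0.
  under eq_bigr do rewrite mulr_natl mulrb.
  rewrite -big_mkcond /=.
  apply: le_trans (fourier_code_le R H hH G S mn hG S0) _.
  by rewrite pG ler_wpM2r ?hm ?(ltW N0).
have : \sum_x g x ^+ 2 <= N.
  rewrite /N -sum1_card natr_sum; apply: ler_sum => x _.
  by rewrite /g; case: (x \in G) => /=; nra.
move=> h; apply: le_trans (ler_wpM2l (sqr_ge0 _) h) _.
by rewrite le_eqVlt; apply/orP; left; apply/eqP; ring.
Qed.
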